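(* For every $n \geq 1$, let $$\mathrm{gcce}(n) = \max \{ \mathrm{cce}(x) : x \text{ is a factor of } \mathbf{t},\ |x| = n \},$$ where $\mathbf{t}$ is the Thue-Morse word and $\mathrm{cce}$ is the circular critical exponent. Then for all $n\geq 1$ we have $$\mathrm{gcce}(n) \in \left\{ 1, 2, 3, \tfrac{7}{2}, 4 \right\}.$$
   Context: The Thue-Morse word $\mathbf{t} = t_0 t_1 t_2 \cdots = 01101001\cdots$ is the infinite fixed point, starting with $0$, of the morphism $\mu$ with $\mu(0)=01$, $\mu(1)=10$. A nonempty finite word $w$ (indexed from $0$) has period $p$, where $1 \le p \le |w|$, if $w[i]=w[i+p]$ for all $i$ with $0 \le i < |w|-p$. The smallest period of $w$ is denoted $p(w)$, and the exponent of $w$ is $\exp(w) = |w|/p(w)$. A factor of a word is a contiguous block inside it. The conjugates of a finite word $w$ are its cyclic shifts, i.e. the words $yx$ with $w = xy$ ($x,y$ possibly empty). The circular critical exponent $\mathrm{cce}(w)$ of a nonempty finite word $w$ is the supremum (maximum) of $\exp(x)$ over all nonempty factors $x$ of all conjugates of $w$. *)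

(* Defs.v *)
From mathcomp Require Import all_boot all_order all_algebra.
From mathcomp Require Import boolp.

Set Implicit Arguments.
Unset Strict Implicit.
Unset Printing Implicit Defensive.

Import Order.TTheory GRing.Theory Num.Theory.

(* The letters 0 and 1 are encoded as false and true; words are indexed
   from 0. *)
Notation word := (seq bool).

Definition mu (w : word) : word := flatten [seq [:: b; ~~ b] | b <- w].

(* The word mu^k(0) has length 2 ^ k > k, so that its letter of index k exists;
   tm_fixed and tm_unique show that tm is the fixed point of mu that starts
   with 0. *)
Definition tm (k : nat) : bool := nth false (iter k mu [:: false]) k.

Definition factor_inf (t : nat -> bool) (w : word) : Prop :=
  exists i : nat, w = mkseq (fun j => t (i + j)) (size w).

(* The default letter of nth is never reached: i + p < size w. *)
Definition has_period (w : word) (p : nat) : bool :=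
  [&& 1 <= p, p <= size w &
      all (fun i => nth false w i == nth false w (i + p)) (iota 0 (size w - p))].

(* Junk value 1 on the empty word; see min_periodP. *)
Definition min_period (w : word) : nat :=
  find (has_period w) (iota 0 (size w).+1).

Definition exponent (w : word) : rat :=
  ((size w)%:R / (min_period w)%:R)%R.

Definition conjugates (w : word) : seq word :=
  [seq rot i w | i <- iota 0 (size w).+1].

(* As exponents are positive, the default value 0 is harmless: see cce_max
   and gcce_max. *)
Definition cce (w : word) : rat :=
  (\big[Num.max/0]_(x : (size w).-bseq bool |
      (0 < size x)%N && has (infix x) (conjugates w)) exponent x)%R.

Definition gcce (n : nat) : rat :=
  (\big[Num.max/0]_(x : n.-tuple bool | `[< factor_inf tm x >]) cce x)%R.

Lemma mu_cat (u v : word) : mu (u ++ v) = mu u ++ mu v.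
Proof. by rewrite /mu map_cat flatten_cat. Qed.

Lemma size_mu (w : word) : size (mu w) = (size w).*2.
Proof. by elim: w => //= b w IHw; rewrite /mu /= -/(mu w) IHw. Qed.

Lemma nth_mu (w : word) k : k < size w ->
  nth false (mu w) k.*2 = nth false w k /\
  nth false (mu w) k.*2.+1 = ~~ nth false w k.
Proof. by elim: w k => //= b w IHw [|k] //= /IHw. Qed.

Lemma size_iter_mu k : size (iter k mu [:: false]) = 2 ^ k.
Proof. by elim: k => //= k IHk; rewrite size_mu IHk expnS mul2n. Qed.

Lemma iter_mu_prefix k : exists v,
  iter k.+1 mu [:: false] = iter k mu [:: false] ++ v.
Proof.
elim: k => [|k [v Ev]]; first by exists [:: true].
by exists (mu v); rewrite iterS {1}Ev mu_cat.
Qed.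

Lemma nth_iter_mu j k i : j <= k -> i < 2 ^ j ->
  nth false (iter k mu [:: false]) i = nth false (iter j mu [:: false]) i.
Proof.
move=> /subnK <- ltij; elim: (k - j) => //= m IHm; rewrite -IHm.
have [v] := iter_mu_prefix (m + j); rewrite /= => ->.
rewrite nth_cat size_iter_mu.
by rewrite (leq_trans ltij) // leq_exp2l // leq_addl.
Qed.

Lemma nth_iter_tm k i : i < 2 ^ k -> nth false (iter k mu [:: false]) i = tm i.
Proof.
move=> ltik; rewrite /tm; case: (leqP k i) => [leki | /ltnW leik].
  exact/esym/nth_iter_mu.
by apply: nth_iter_mu; last exact: ltn_expl.
Qed.

Lemma tm_double k : tm k.*2 = tm k /\ tm k.*2.+1 = ~~ tm k.
Proof.
have ltk : k < 2 ^ k by rewrite ltn_expl.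
have [] := @nth_mu (iter k mu [:: false]) k; first by rewrite size_iter_mu.
rewrite -iterS !nth_iter_tm ?expnS ?mul2n ?ltn_double ?ltn_Sdouble //.
Qed.

Lemma mu_mkseq (t : nat -> bool) n :
  mu (mkseq t n.+1) = mu (mkseq t n) ++ [:: t n; ~~ t n].
Proof. by rewrite mkseqS -cats1 mu_cat. Qed.

Lemma tm_fixed : tm 0 = false /\
  forall n, mkseq tm n.*2 = mu (mkseq tm n).
Proof.
split=> //; elim=> // n IHn; rewrite mu_mkseq -IHn doubleS !mkseqS.
by have [-> ->] := tm_double n; rewrite -!cats1 -catA.
Qed.

Lemma tm_unique (t : nat -> bool) : t 0 = false ->
  (forall n, mkseq t n.*2 = mu (mkseq t n)) -> t =1 tm.
Proof.
move=> t0 tfix k.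
have E n : mkseq t (2 ^ n) = iter n mu [:: false].
  by elim: n => [|n IHn]; rewrite ?expnS ?mul2n ?tfix ?IHn //= /mkseq /= t0.
have ltk : k < 2 ^ k by exact: ltn_expl.
by rewrite /tm -E (nth_mkseq _ _ ltk).
Qed.

Lemma min_periodP (w : word) : w != [::] ->
  has_period w (min_period w) /\
  forall p, has_period w p -> min_period w <= p.
Proof.
move=> w0; have per_w : has_period w (size w).
  by rewrite /has_period leqnn lt0n size_eq0 w0 subnn.
have hasw : has (has_period w) (iota 0 (size w).+1).
  by apply/hasP; exists (size w); rewrite // mem_iota add0n leqnn.
have ltm : min_period w < (size w).+1 by rewrite -[ltnRHS](size_iota 0) -has_find.
split; first by have := nth_find 0 hasw; rewrite nth_iota.
move=> p per_p; rewrite leqNgt; apply/negP => ltp.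
have := before_find 0 ltp; rewrite nth_iota ?add0n ?per_p //.
exact: ltn_trans ltp ltm.
Qed.

Lemma exponent_gt0 (w : word) : w != [::] -> (0 < exponent w)%R.
Proof.
move=> w0; have [/and3P[m0 _ _] _] := min_periodP w0.
by rewrite divr_gt0 // ltr0n // lt0n size_eq0.
Qed.

Lemma cce_max (w : word) : w != [::] ->
  (exists x : word, [/\ x != [::],
     exists2 v, v \in conjugates w & infix x v & exponent x = cce w]) /\
  (forall x v : word, x != [::] -> v \in conjugates w -> infix x v ->
     (exponent x <= cce w)%R).
Proof.
move=> w0.
have size_conj v : v \in conjugates w -> size v = size w.
  by case/mapP => i _ ->; rewrite size_rot.
split; last first.
  move=> x v x0 cv xv; have sx : size x <= size w.
    by rewrite -(size_conj v cv) size_infix.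
  rewrite /cce; apply: (@le_bigmax_cond _ _ _ _ (Bseq sx)).
  by apply/andP; rewrite lt0n size_eq0 x0; split=> //; apply/hasP; exists v.
have ww : w \in conjugates w by apply/mapP; exists 0; rewrite ?rot0.
have [||x] := @eq_bigmax _ _ _ 0%R (Bseq (leqnn (size w)))
  [pred x : (size w).-bseq bool |
    (0 < size x) && has (infix x) (conjugates w)] (fun x => exponent x).
- apply/andP; rewrite lt0n size_eq0 w0; split=> //.
  by apply/hasP; exists w; rewrite ?infix_refl.
- by move=> x /andP[x0 _]; rewrite ltW // exponent_gt0 // -size_eq0 -lt0n.
case/andP=> x0 /hasP[v cv xv] Ex; exists x; split; last by rewrite /cce -Ex.
  by rewrite -size_eq0 -lt0n.
by exists v.
Qed.

Lemma cce_gt0 (w : word) : w != [::] -> (0 < cce w)%R.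
Proof. by case/cce_max=> -[x [x0 _ <-]] _; apply: exponent_gt0. Qed.

Lemma gcce_max (n : nat) : 1 <= n ->
  (exists x : word, [/\ factor_inf tm x, size x = n & cce x = gcce n]) /\
  (forall x : word, factor_inf tm x -> size x = n -> (cce x <= gcce n)%R).
Proof.
move=> n_gt0; split; last first.
  move=> x fx /eqP sx; rewrite /gcce.
  by apply: (@le_bigmax_cond _ _ _ _ (Tuple sx)); apply/asboolP.
have [||x] := @eq_bigmax _ _ _ 0%R (Tuple (introT eqP (size_mkseq tm n)))
  [pred x : n.-tuple bool | `[< factor_inf tm x >]] (fun x => cce x).
- by apply/asboolP; exists 0; rewrite /= size_mkseq.
- by move=> x _; rewrite ltW // cce_gt0 // -size_eq0 size_tuple -lt0n.
move=> /asboolP fx Ex; exists x; split=> //.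
exact: size_tuple.
Qed.

(* Main.v *)
(* The maximum is 4 for even n >= 6; for odd n >= 5 it is 7/2 if n = 3 mod 4
   and n is neither 3 nor 15, and 3 otherwise; the case n <= 4 is trivial.

   Upper bounds: a factor of a conjugate of w = t[i..i+n) is a factor of w, of
   exponent at most 2 because t is overlap-free, or a suffix of w followed by a
   prefix of w.  Hence the exponent is at most 4.  If n is odd and the exponent
   exceeds 3, then one of the two parts repeats a long factor, at distance the
   period p, inside itself and inside the other part.  Equal letters
   t_j = t_(j+1) occur only at odd j, and every factor of length 5 contains
   some, so the parity of a position is determined by the 5 letters read there.
   This excludes p = 6 and p >= 8, and the remaining p are a finite check, which
   leaves only p = 2 and n = 3 mod 4.

   Lower bounds: for d >= 4, each of 01, 10 occurs in t at distance d from each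
   of 01, 10 (by induction on d).  Applying mu or mu^2 to such pairs gives
   aa...aa, a...aa and aba...abab at the required distances. *)
Require Import Defs.
From mathcomp Require Import all_boot all_order all_algebra.
From mathcomp Require Import zify.

Set Implicit Arguments.
Unset Strict Implicit.
Unset Printing Implicit Defensive.

Import Order.TTheory GRing.Theory Num.Theory.

(** * Factors of the Thue-Morse word as windows, and their enumeration *)

Lemma tm_even k : tm k.*2 = tm k. Proof. by case: (tm_double k). Qed.

Lemma tm_odd k : tm k.*2.+1 = ~~ tm k. Proof. by case: (tm_double k). Qed.

Definition win i L : word := mkseq (fun j => tm (i + j)) L.

Lemma size_win i L : size (win i L) = L.
Proof. exact: size_mkseq. Qed.

Lemma nth_win i L j : j < L -> nth false (win i L) j = tm (i + j).
Proof. by move=> ltjL; rewrite nth_mkseq. Qed.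

Lemma win_cat i L M : win i (L + M) = win i L ++ win (i + L) M.
Proof.
rewrite /win /mkseq iotaD map_cat add0n -{2}[L]addn0 iotaDl -map_comp.
by congr (_ ++ _); apply: eq_map => j /=; rewrite addnA.
Qed.

Lemma drop_win s i L : drop s (win i L) = win (i + s) (L - s).
Proof.
case: (leqP s L) => [lesL | /ltnW leLs].
  by rewrite -{1}(subnKC lesL) win_cat drop_size_cat ?size_win.
have -> : L - s = 0 by apply/eqP.
by rewrite drop_oversize ?size_win.
Qed.

Lemma take_win l i L : take l (win i L) = win i (minn l L).
Proof.
case: (leqP l L) => [lelL | /ltnW leLl]; last by rewrite take_oversize ?size_win.
by rewrite -{1}(subnKC lelL) win_cat take_size_cat ?size_win.
Qed.

Lemma win_double i L : win i.*2 L.*2 = mu (win i L).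
Proof.
elim: L => // L IHL.
rewrite {2}/win mu_mkseq -/(win i L) -IHL doubleS -addn2 win_cat.
by rewrite /win /= /mkseq /= addn0 addn1 -doubleD tm_even tm_odd.
Qed.

Lemma win_iter_mu k i L : win (2 ^ k * i) (2 ^ k * L) = iter k mu (win i L).
Proof.
by elim: k => [|k IHk]; rewrite ?mul1n // expnS -!mulnA !mul2n win_double IHk.
Qed.

(* All pairs (i mod 4, t[i..i+L)) for L <= 16, such a factor being contained in
   some mu^4(ab). *)
Definition windows L : seq (nat * word) :=
  [seq (r %% 4, take L (drop r (iter 4 mu w))) |
    w <- [:: [:: false; false]; [:: false; true]; [:: true; false]; [:: true; true]],
    r <- iota 0 16].

(** With i = 16q + r, the factor starts at offset r of mu^4(t_q t_(q+1)), of length 32 >= r + L. *)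
Lemma mem_windows i L : L <= 16 -> (i %% 4, win i L) \in windows L.
Proof.
move=> leL.
have lti16 : i %% 16 < 16 by rewrite ltn_mod.
have -> : i %% 4 = (i %% 16) %% 4 by rewrite modn_dvdm.
have -> : win i L = take L (drop (i %% 16) (iter 4 mu (win (i %/ 16) 2))).
  rewrite -win_iter_mu drop_win take_win.
  rewrite [2 ^ 4 * _]mulnC -divn_eq (minn_idPl _) //; lia.
apply: (@allpairs_f _ _ _ (fun w r => (r %% 4, take L (drop r (iter 4 mu w))))).
  by rewrite /win /mkseq /=; case: (tm _); case: (tm _).
by rewrite mem_iota.
Qed.

Lemma windowsP L (Q : nat -> word -> bool) : L <= 16 ->
  all (fun rw => Q rw.1 rw.2) (windows L) -> forall i, Q (i %% 4) (win i L).
Proof. by move=> leL /allP ok i; apply: (ok (_, _)); apply: mem_windows. Qed.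

(** * Periods, parity of positions and overlap-freeness *)

Lemma has_periodP (w : word) p :
  reflect ([/\ 0 < p, p <= size w &
            forall j, j + p < size w -> nth false w j = nth false w (j + p)])
          (has_period w p).
Proof.
apply: (iffP and3P) => [[p0 pw /allP ok] | [p0 pw ok]]; split=> //.
  by move=> j ltj; apply/eqP/ok; rewrite mem_iota add0n ltn_subRL addnC.
by apply/allP => j; rewrite mem_iota add0n ltn_subRL addnC => ltj; apply/eqP/ok.
Qed.

Lemma has_period_infix (x w : word) p :
  infix x w -> p <= size x -> has_period w p -> has_period x p.
Proof.
case/infixP => s1 [s2 ->] px /has_periodP [p0 _ ok]; apply/has_periodP; split=> //.
move=> j ltj; have := ok (size s1 + j); rewrite !size_cat !nth_cat -addnA.
rewrite !ltn_add2l !addKn !(ltnNge (size s1 + _)) !leq_addr /= ltj.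
by rewrite (leq_ltn_trans _ ltj) ?leq_addr //; apply; rewrite ltn_addr.
Qed.

Lemma tm_eqS_odd j : tm j = tm j.+1 -> odd j.
Proof.
rewrite -{1 2}(odd_double_half j); case: (odd j) => //.
by rewrite add0n tm_even tm_odd; case: (tm _).
Qed.

Lemma tm_square5 j : exists2 c, c < 4 & tm (j + c) = tm (j + c).+1.
Proof.
have := @windowsP 5
  (fun _ w => has (fun c => nth false w c == nth false w c.+1) (iota 0 4)).
move=> /(_ isT) /(_ ltac:(by vm_compute)) /(_ j) /hasP [c].
rewrite mem_iota add0n => /andP[_ ltc] /eqP Ec; exists c => //.
by move: Ec; rewrite !nth_win ?addnS // ltnW.
Qed.

(** Two equal neighbours occur at some offset among the five letters, the same in both factors, and
    start at an odd position in each. *)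
Lemma eq5_odd i j : (forall c, c < 5 -> tm (i + c) = tm (j + c)) ->
  odd i = odd j.
Proof.
move=> eqij; have [c ltc Ec] := tm_square5 i; have := tm_eqS_odd Ec.
rewrite -addnS !eqij ?addnS ?ltnS // in Ec; last exact: ltnW.
by have := tm_eqS_odd Ec; rewrite !oddD; case: (odd c); case: (odd i); case: (odd j).
Qed.

(** Descent on p. For even p, the letters at the positions of the parity of i form t or its
    complement, which halves p. For odd p >= 5, [eq5_odd] gives i and i + p the same parity; p = 1
    and p = 3 are enumerated. *)
Lemma tm_overlap_free i p : 0 < p ->
  ~ (forall j, j <= p -> tm (i + j) = tm (i + j + p)).
Proof.
elim/ltn_ind: p i => p IHp i p0 ov.
case: (boolP (odd p)) => [oddp | evenp].
  case: (ltnP p 5) => [ltp5 | lep5].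
    have: has_period (win i p.*2.+1) p.
      apply/has_periodP; rewrite size_win; split=> //; first by lia.
      by move=> j ltj; rewrite !nth_win ?addnA ?ov //; lia.
    case: p p0 oddp ltp5 {IHp ov} => [|[|[|[|[|p]]]]] // _ _ _; apply/negP.
      by apply: (@windowsP 3 (fun _ w => ~~ has_period w 1)) => //; vm_compute.
    by apply: (@windowsP 7 (fun _ w => ~~ has_period w 3)) => //; vm_compute.
  suff: odd i = odd (i + p) by rewrite oddD oddp; case: (odd i).
  by apply: eq5_odd => c ltc; rewrite ov 1?addnAC // -ltnS (leq_trans ltc) // ltnW.
rewrite -(even_halfK evenp) in IHp p0 ov *; set q := p./2 in IHp p0 ov.
apply: (IHp q _ i./2); [lia | lia |] => j lej.
have := ov j.*2; rewrite leq_double => /(_ lej); rewrite -{1 2}(odd_double_half i).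
rewrite -!addnA -!doubleD; case: (odd i) => /=; rewrite ?add1n ?add0n.
  by rewrite !tm_odd !addnA => /negb_inj.
by rewrite !tm_even !addnA.
Qed.

(** * Repetitions inside a factor and across the junction of two factors *)

Lemma size_win_period i L p : has_period (win i L) p -> L <= p.*2.
Proof.
case/has_periodP; rewrite size_win => p0 lepL ok.
rewrite leqNgt; apply/negP => ltL; apply: (@tm_overlap_free i p) => // j lej.
by have := ok j ltac:(lia); rewrite !nth_win ?addnA //; lia.
Qed.

(** Overlap-freeness bounds each part separately, hence the exponent of the whole by 4. *)
Lemma size_cat_period e A i B p :
  has_period (win e A ++ win i B) p -> A <= p.*2 /\ B <= p.*2.
Proof.
move=> per; split.
  case: (leqP p A) => [lepA | ?]; last by lia.
  apply: (@size_win_period e); apply: has_period_infix per; rewrite ?size_win //.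
  exact: infix_catr (infix_refl _).
case: (leqP p B) => [lepB | ?]; last by lia.
apply: (@size_win_period i); apply: has_period_infix per; rewrite ?size_win //.
exact: infix_catl (infix_refl _).
Qed.

Lemma nth_cat_win e A i B k : k < A + B ->
  nth false (win e A ++ win i B) k = if k < A then tm (e + k) else tm (i + (k - A)).
Proof.
move=> ltk; rewrite nth_cat size_win.
by case: ltnP => ?; rewrite nth_win //; lia.
Qed.

(* A repetition of length more than 3p can be trimmed to length 3p + 1. *)
Definition exponent_le3_at p A := let B := (3 * p).+1 - A in
  all (fun rU => all (fun sV =>
      has_period (rU.2 ++ sV.2) p && odd (rU.1 + A + sV.1) ==>
        (p == 2) && (rU.1 + A == sV.1 + 3 %[mod 4]))
    (windows B)) (windows A).

(** As A, B <= 2p and A + B > 3p, the length A ranges over p+1..2p; for p <= 7 all parts are short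
    enough for [windows]. *)
Lemma exponent_le3_small :
  all (fun pA => exponent_le3_at pA.1 pA.2)
    [seq (p, p + a) | p <- [:: 1; 2; 3; 4; 5; 7], a <- iota 1 p].
Proof. by vm_compute. Qed.

(** When e + A = i + n, the parity hypothesis says that n is odd, and the conclusion that p = 2 and
    n = 3 mod 4. *)
Lemma exponent_le3 e A i B p : odd (e + A + i) ->
    has_period (win e A ++ win i B) p -> 3 * p < A + B ->
  p = 2 /\ e + A = i + 3 %[mod 4].
Proof.
move=> odd_eAi per gt3p; have [leA leB] := size_cat_period per.
have /has_periodP[p0 _ ok] := per.
have okU k : k + p < A -> tm (e + k) = tm (e + k + p).
  move=> ltk; have := ok k; rewrite size_cat !size_win !nth_cat_win; [|lia..].
  by rewrite ltk (leq_ltn_trans _ ltk) ?leq_addr // addnA; apply; lia.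
have okV k : k + p < B -> tm (i + k) = tm (i + k + p).
  move=> ltk; have := ok (A + k); rewrite size_cat !size_win !nth_cat_win; [|lia..].
  by rewrite -addnA !(ltnNge (A + _)) !leq_addr !addKn (addnA i); apply; lia.
have okUV k l : k < A -> l < B -> k + p = A + l -> tm (e + k) = tm (i + l).
  move=> ltk ltl Ekl; have := ok k; rewrite size_cat !size_win !nth_cat_win; [|lia..].
  by rewrite ltk Ekl (ltnNge _ A) leq_addr addKn; apply; lia.
have ltpA : p < A by lia.
have ltpB : p < B by lia.
case: (boolP (p \in [:: 1; 2; 3; 4; 5; 7])) => [small_p | large_p].
  (* Trimming acts at the outer ends only, so the junction, [e + A] and [i] are kept. *)
  pose A' := minn A p.*2; pose B' := (3 * p).+1 - A'.
  have leA' : A' <= A by exact: geq_minl.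
  have leB' : B' <= B by rewrite /B' /A'; lia.
  have ltpA' : p < A' by rewrite /A'; lia.
  have leA'2 : A' <= p.*2 by exact: geq_minr.
  have le7p : p <= 7 by move: small_p; rewrite !inE; lia.
  have per' : has_period (win (e + (A - A')) A' ++ win i B') p.
    apply: has_period_infix per; last by rewrite size_cat !size_win; lia.
    apply/infixP; exists (win e (A - A')), (win (i + B') (B - B')).
    rewrite -{1}(subnK leA') win_cat -{1}(subnKC leB') win_cat.
    by rewrite -!catA.
  have in_list : (p, A') \in
      [seq (p, p + a) | p <- [:: 1; 2; 3; 4; 5; 7], a <- iota 1 p].
    apply/allpairsPdep; exists p, (A' - p); split=> //; last by rewrite subnKC // ltnW.
    by rewrite mem_iota; lia.
  have leA'16 : A' <= 16 by lia.
  have leB'16 : B' <= 16 by rewrite /B'; lia.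
  have : exponent_le3_at p A' := allP exponent_le3_small _ in_list.
  rewrite /exponent_le3_at -/B' => /allP/(_ _ (mem_windows (e + (A - A')) leA'16)) /allP.
  move=> /(_ _ (mem_windows i leB'16)); rewrite [fst _]/= [fst _]/= per' => /implyP.
  have -> : odd ((e + (A - A')) %% 4 + A' + i %% 4) by lia.
  by move=> /(_ isT) /andP[/eqP-> /eqP Emod]; split=> //; lia.
(* For odd p >= 9, A + B > 3p >= 2(p + 4), so one part has length at least p + 5 and repeats five
   letters at the odd distance p. *)
case: (boolP (odd p)) => oddp.
  have ge9 : 9 <= p by move: large_p; rewrite !inE; lia.
  have [geA | geB] : p + 5 <= A \/ p + 5 <= B by lia.
    suff: odd e = odd (e + p) by rewrite oddD oddp; case: (odd e).
    by apply: eq5_odd => c ltc; rewrite okU 1?addnAC //; lia.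
  suff: odd i = odd (i + p) by rewrite oddD oddp; case: (odd i).
  by apply: eq5_odd => c ltc; rewrite okV 1?addnAC //; lia.
(* For even p >= 6, five letters of the left part recur p letters later in the right part, at
   positions of t of the other parity since [e + A + i] is odd. *)
have ge6 : 6 <= p by move: large_p; rewrite !inE; lia.
have [geA | geB] : p + 4 <= A \/ p + 4 <= B by lia.
  suff: odd (e + (A - p)) = odd i by lia.
  by apply: eq5_odd => c ltc; rewrite -addnA; apply: okUV; lia.
suff: odd (e + (A - 5)) = odd (i + (p - 5)) by lia.
by apply: eq5_odd => c ltc; rewrite -!addnA; apply: okUV; lia.
Qed.

(** At an odd position, a factor abab would come under [mu] from a cube in t. *)
Lemma even_of_period2 i : has_period (win i 4) 2 -> ~~ odd i.
Proof.
have := @windowsP 4 (fun r w => has_period w 2 ==> ~~ odd r) isT.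
move=> /(_ ltac:(by vm_compute)) /(_ i) /implyP even_i /even_i; lia.
Qed.

(** The parts have length at most 4, hence 3 and 4 in some order, and both lie in one window of
    length 15, which is enumerated. *)
Lemma no_exponent_7_2_at_15 e i A B : e + A = i + 15 -> A + B = 7 ->
  ~~ has_period (win e A ++ win i B) 2.
Proof.
move=> eA AB; apply/negP => per; have [leA leB] := size_cat_period per.
have := @windowsP 15 (fun _ w =>
  ~~ has_period (drop 12 w ++ take 4 w) 2 && ~~ has_period (drop 11 w ++ take 3 w) 2).
move=> /(_ isT) /(_ ltac:(by vm_compute)) /(_ i).
rewrite !drop_win !take_win !minnE /= => /andP[/negP no34 /negP no43].
have [[EA EB] | [EA EB]] : (A = 3 /\ B = 4) \/ (A = 4 /\ B = 3) by lia.
  by apply: no34; move: per; rewrite EA EB; have -> : e = i + 12 by lia.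
by apply: no43; move: per; rewrite EA EB; have -> : e = i + 11 by lia.
Qed.

(** * Passage between repetitions and [gcce] *)

Lemma exponent_ge (w : word) p : has_period w p ->
  ((size w)%:R / p%:R <= exponent w)%R.
Proof.
move=> per; have /and3P[p0 lep _] := per.
have w0 : w != [::] by rewrite -size_eq0 -lt0n (leq_trans p0).
have [/and3P[m0 _ _] /(_ _ per) lemp] := min_periodP w0.
by rewrite ler_wpM2l ?ler0n // lef_pV2 ?posrE ?ltr0n // ler_nat.
Qed.

Lemma rot_win k i n : k <= n ->
  rot k (win i n) = win (i + k) (n - k) ++ win i k.
Proof. by move=> lekn; rewrite /rot drop_win take_win (minn_idPl lekn). Qed.

(** [e + A = i + n] makes [win e A] a suffix of [win i n], so the repetition is a prefix of the
    conjugate that starts with this suffix. *)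
Lemma gcce_ge n i e p A B : e + A = i + n -> A + B <= n ->
  has_period (win e A ++ win i B) p -> ((A + B)%:R / p%:R <= gcce n)%R.
Proof.
move=> eA leAB per; set x := _ ++ _ in per.
have sx : size x = A + B by rewrite size_cat !size_win.
have /and3P[p0 lep _] := per.
have n0 : 0 < n by rewrite (leq_trans p0) // (leq_trans lep) // sx.
have fact_w : factor_inf tm (win i n) by exists i; rewrite size_win.
apply: le_trans (proj2 (gcce_max n0) _ fact_w (size_win _ _)).
rewrite -sx; apply: le_trans (exponent_ge per) _.
have w0 : win i n != [::] by rewrite -size_eq0 size_win -lt0n.
apply: (proj2 (cce_max w0) x (rot (n - A) (win i n))).
- by rewrite -size_eq0 -lt0n (leq_trans p0).
- by apply/mapP; exists (n - A); rewrite ?mem_iota ?size_win //; lia.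
rewrite rot_win ?leq_subr //.
have -> : i + (n - A) = e by lia.
have -> : n - (n - A) = A by lia.
apply/infixP; exists [::], (win (i + B) (n - A - B)).
by rewrite /x -catA -win_cat subnKC //; lia.
Qed.

(** A factor of maximal exponent lies in a suffix of w followed by a prefix of w: either inside one
    of them, where overlap-freeness applies, or across the junction. *)
Lemma gcce_exponent n : 0 < n -> exists s p,
  [/\ gcce n = (s%:R / p%:R)%R, 0 < p, p <= s <= n &
      s <= p.*2 \/ exists e i A B,
        [/\ A + B = s, e + A = i + n & has_period (win e A ++ win i B) p]].
Proof.
move=> n0; have [[w [[i Ew] sw <-]] _] := gcce_max n0.
rewrite sw -/(win i n) in Ew; rewrite {}Ew {w sw}.
have w0 : win i n != [::] by rewrite -size_eq0 size_win -lt0n.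
have [[x [x0 [v /mapP[k lekn ->] inf_x] <-]] _] := cce_max w0.
move: lekn inf_x; rewrite mem_iota size_win add0n ltnS => /andP[_ lekn].
rewrite rot_win // => inf_x.
have [per _] := min_periodP x0; have /and3P[p0 lep _] := per.
exists (size x), (min_period x); split=> //.
  by rewrite lep (leq_trans (size_infix inf_x)) // size_cat !size_win subnK.
case/infixP: inf_x => s1 [s2 Ex].
have {Ex} Ex : x = take (size x) (drop (size s1) (win (i + k) (n - k) ++ win i k)).
  by rewrite Ex drop_size_cat // take_size_cat.
have winE j : x = win j (size x) -> size x <= (min_period x).*2.
  by move=> Ej; apply: (@size_win_period j); rewrite -Ej.
move: Ex; rewrite drop_cat size_win; case: ltnP => [lts1 | _]; last first.
  rewrite drop_win take_win => Ex; have sx := congr1 size Ex; rewrite size_win in sx.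
  by left; apply: winE; rewrite {1}Ex -sx.
rewrite drop_win take_cat size_win; case: ltnP => [ltx | lex].
  rewrite take_win (minn_idPl (ltnW ltx)) => Ex; left; exact: winE Ex.
rewrite take_win => Ex; right; have sx := congr1 size Ex.
rewrite size_cat !size_win in sx.
exists (i + k + size s1), i, (n - k - size s1), (minn (size x - (n - k - size s1)) k).
by split; [by [] | lia | rewrite -Ex].
Qed.

(** For n too small for [sign_changes]: a search among the first 128 letters of t, the guard keeping
    the whole factor inside. *)
Lemma gcce_ge_small n p A B : A + B <= n ->
    (let t := iter 7 mu [:: false] in
     has (fun i => (i + n <= 128) &&
       has_period (take A (drop (i + (n - A)) t) ++ take B (drop i t)) p)
     (iota 0 32)) ->
  ((A + B)%:R / p%:R <= gcce n)%R.
Proof.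
move=> leAB /hasP[i _ /andP[lei]].
have -> : iter 7 mu [:: false] = win 0 128.
  by rewrite (win_iter_mu 7 0 1).
rewrite !drop_win !take_win !add0n !(minn_idPl _); [|lia..].
by apply: gcce_ge => //; lia.
Qed.

(** * Lower bounds for [gcce] *)

Lemma sign_changes d a b : 4 <= d -> exists i,
  [/\ tm i = a, tm i.+1 = ~~ a, tm (i + d) = b & tm (i + d).+1 = ~~ b].
Proof.
elim/ltn_ind: d a b => d IHd a b le4d.
(* The base cases are the d >= 4 whose half (d even) or quarter (d odd), rounded down, is below
   4. *)
case: (boolP (d \in [:: 4; 5; 6; 7; 9; 11; 13; 15])) => [small_d | large_d].
  pose t := iter 7 mu [:: false]; pose tt i := nth false t i.
  have ttE i : i < 128 -> tt i = tm i by exact: (@nth_iter_tm 7).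
  have chk : all (fun d => all (fun a => all (fun b => has (fun i =>
      [&& tt i == a, tt i.+1 == ~~ a, tt (i + d) == b & tt (i + d).+1 == ~~ b])
      (iota 0 64)) [:: false; true]) [:: false; true]) [:: 4; 5; 6; 7; 9; 11; 13; 15].
    by vm_compute.
  have mem_bool c : c \in [:: false; true] by case: c.
  have := allP (allP (allP chk _ small_d) a (mem_bool a)) b (mem_bool b).
  case/hasP => i; rewrite mem_iota add0n => /andP[_ lti].
  have led : d <= 15 by move: small_d; rewrite !inE; lia.
  rewrite !ttE; [|lia..].
  by case/and4P => /eqP ? /eqP ? /eqP ? /eqP ?; exists i.
(* For even d, [mu] is applied to letters a and b at distance d/2. *)
case: (boolP (odd d)) => oddd; last first.
  have [||i [ia _ ib _]] := IHd d./2 _ a b; first by lia.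
    by move: large_d; rewrite !inE; lia.
  have Ed : d = d./2.*2 by lia.
  exists i.*2; rewrite Ed -doubleD !tm_even !tm_odd ia ib; split=> //.
have ge16 : 16 <= d by move: large_d; rewrite !inE; lia.
(* For odd d = 2j + 1, the second change straddles two blocks of [mu], the images of two equal
   letters [~~ b]. *)
have [j Ed] : exists j, d = j.*2.+1 by exists d./2; lia.
have [i [ia ib1 ib2]] : exists i,
    [/\ tm i = a, tm (i + j) = ~~ b & tm (i + j).+1 = ~~ b].
  (* The block aa lies at an odd position 2k+1, with t_k <> t_(k+1). *)
  have [l Ej] : exists l, j = odd j + l.*2 by exists j./2; lia.
  (* The new start [~~ odd j + i.*2] is odd exactly when j is even, and then [tm_odd] negates the
     letter. *)
  have [||i [ia _ ib1 ib2]] := IHd l _ (~~ odd j (+) a) b; [lia | lia |].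
  have Eij : ~~ odd j + i.*2 + j = (i + l).*2.+1 by lia.
  exists (~~ odd j + i.*2); rewrite Eij -doubleS tm_odd tm_even ib1 ib2; split=> //.
  by case: (odd j) ia => /=; rewrite ?add0n ?add1n ?tm_even ?tm_odd => -> //; rewrite negbK.
exists i.*2; rewrite tm_even tm_odd Ed addnS -doubleD -doubleS tm_odd tm_even.
by rewrite ia ib1 ib2 negbK.
Qed.

(** For n >= 10, 00 meets 00 at the junction, each being the middle of mu(10) = 1001. *)
Lemma gcce_even_ge4 n : ~~ odd n -> 6 <= n -> (4 <= gcce n)%R.
Proof.
move=> evenn le6n; have -> : (4 = (2 + 2)%:R / 1%:R :> rat)%R by rewrite divr1.
case: (boolP (n \in [:: 6; 8])) => [|large_n].
  by rewrite !inE => /pred2P[] ->; apply: gcce_ge_small => //; vm_compute.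
have [m En] : exists m, n = m.*2.+2 by exists n./2.-1; lia.
have [|i [ia ia1 ib ib1]] := @sign_changes m true true.
  by move: large_n; rewrite !inE; lia.
apply: (@gcce_ge n i.*2.+1 (i + m).*2.+1); [by rewrite En; lia | by lia |].
rewrite /win /mkseq /= !addn0 !addn1 -!doubleS !tm_odd !tm_even ia ia1 ib ib1.
by [].
Qed.

(** For n >= 11, 11 from the middle of mu(01) = 0110 meets the first letter of mu(1) = 10. *)
Lemma gcce_odd_ge3 n : odd n -> 5 <= n -> (3 <= gcce n)%R.
Proof.
move=> oddn le5n; have -> : (3 = (2 + 1)%:R / 1%:R :> rat)%R by rewrite divr1.
case: (boolP (n \in [:: 5; 7; 9])) => [|large_n].
  by rewrite !inE => /or3P[] /eqP->; apply: gcce_ge_small => //; vm_compute.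
have [m En] : exists m, n = m.*2.+3 by exists n./2.-1; lia.
have [|i [ia ia1 ib ib1]] := @sign_changes m true false.
  by move: large_n; rewrite !inE; lia.
apply: (@gcce_ge n i.*2 (i + m).*2.+1); [by rewrite En; lia | by lia |].
rewrite /win /mkseq /= !addn0 !addn1 -!doubleS !tm_odd !tm_even ia ib ib1.
by [].
Qed.

(** For n >= 19, 1010 from the middle of mu^2(01) = 01101001 meets 101 from mu^2(10) = 10010110. *)
Lemma gcce_mod4_ge72 n : n %% 4 = 3 -> 7 <= n -> n != 15 -> (7 / 2 <= gcce n)%R.
Proof.
move=> modn le7n n15; change (7 / 2 : rat)%R with ((4 + 3)%:R / 2%:R : rat)%R.
case: (boolP (n \in [:: 7; 11])) => [|large_n].
  by rewrite !inE => /pred2P[] ->; apply: gcce_ge_small => //; vm_compute.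
have [m En] : exists m, n = 4 * m + 3 by exists (n %/ 4); lia.
have [|i [ia ia1 ib ib1]] := @sign_changes m true false.
  by move: large_n; rewrite !inE; lia.
apply: (@gcce_ge n (4 * i + 3) (4 * (i + m) + 2)); [by rewrite En; lia | by lia |].
have winE j : win (4 * j + 2) 4 = [:: ~~ tm j; tm j; tm j.+1; ~~ tm j.+1].
  have -> : win (4 * j + 2) 4 = take 4 (drop 2 (win (2 ^ 2 * j) (2 ^ 2 * 2))).
    by rewrite drop_win take_win.
  by rewrite win_iter_mu /win /mkseq /= addn0 addn1 negbK.
have -> : win (4 * i + 3) 3 = drop 1 (win (4 * i + 2) 4).
  by rewrite drop_win -addnA.
by rewrite !winE ia ia1 ib ib1.
Qed.

Theorem theorem14 (n : nat) (hn : (1 <= n)%N) :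
  gcce n \in [:: 1; 2; 3; 7 / 2; 4]%R.
Proof.
have [s [p [Eg p0 /andP[leps lesn] dich]]] := gcce_exponent hn.
have p0R : (0 < p%:R :> rat)%R by rewrite ltr0n.
have leg k : s <= k * p -> (gcce n <= k%:R)%R.
  by move=> lesk; rewrite Eg ler_pdivrMr // -natrM ler_nat.
have le4p : s <= 4 * p.
  case: dich => [|[e [i [A [B [<- _ /size_cat_period[]]]]]]]; lia.
have eq_nat (k : nat) : (k%:R <= gcce n)%R -> s <= k * p -> gcce n = k%:R%R.
  by move=> gek lesk; apply/le_anti; rewrite gek leg.
rewrite !inE.
have [le4n | gt4n] := leqP n 4.
  case: (ltnP n 2) => [lt2n | le2n].
    have -> : gcce n = 1%R; last by rewrite eqxx.
    rewrite Eg; have -> : s = 1 by lia.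
    by have -> : p = 1 by lia; rewrite divr1.
  (* A repeated letter gives 2p <= s <= 4, so p = 1, or p = 2 and s = 4. *)
  have ge2 : (2 <= gcce n)%R.
    have -> : (2 = (1 + 1)%:R / 1%:R :> rat)%R by rewrite divr1.
    have : n \in [:: 2; 3; 4] by rewrite !inE; lia.
    by rewrite !inE => /or3P[] /eqP->; apply: gcce_ge_small => //; vm_compute.
  have le2ps : 2 * p <= s by move: ge2; rewrite Eg ler_pdivlMr // -natrM ler_nat.
  have [Ep | Ep] : p = 1 \/ p = 2 by lia.
    move: Eg; rewrite Ep divr1 => ->.
    have [->|[->|->]] : s = 2 \/ s = 3 \/ s = 4 by lia.
    - by [].
    - by [].
    - by [].
  by move: Eg; rewrite Ep => ->; have -> : s = 4 by lia.
case: (boolP (odd n)) => oddn; last first.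
  by rewrite (eq_nat 4) ?gcce_even_ge4 ?eqxx ?orbT //; lia.
have ge3 := gcce_odd_ge3 oddn gt4n.
have [le3p | gt3p] := leqP s (3 * p); first by rewrite (eq_nat 3) ?eqxx ?orbT.
have [e [i [A [B [AB eA per]]]]] : exists e i A B,
    [/\ A + B = s, e + A = i + n & has_period (win e A ++ win i B) p].
  by case: dich => //; lia.
have [||Ep mod3] := exponent_le3 _ per; [lia | lia |].
have modn : n %% 4 = 3 by lia.
have le7s : 7 <= s by lia.
(* With p = 2, s is 7 or 8; s = 8 forces A = B = 4, hence e and i even, and n would be even. *)
have s7 : s = 7.
  apply/eqP; rewrite eqn_leq le7s andbT leqNgt; apply/negP => gt7s.
  have [leA leB] := size_cat_period per.
  have [EA EB] : A = 4 /\ B = 4 by lia.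
  rewrite Ep EA EB in per eA.
  have perE : has_period (win e 4) 2.
    by apply: has_period_infix per; rewrite ?size_win // infix_catr ?infix_refl.
  have perI : has_period (win i 4) 2.
    by apply: has_period_infix per; rewrite ?size_win // infix_catl ?infix_refl.
  have := even_of_period2 perI; have := even_of_period2 perE; lia.
have n15 : n != 15.
  apply/eqP => En; rewrite En in eA; rewrite s7 in AB.
  by have := no_exponent_7_2_at_15 eA AB; rewrite -Ep per.
by rewrite Eg s7 Ep eqxx !orbT.
Qed.
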